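(* For all simple graphs $G$ and $H$, $$\langle \pi^+_{\bar G},\pi^+_{\bar H}\rangle=c(G\triangledown H).$$
   Context: Graphs are finite, without loops or multiple edges, and have at least one vertex. $\bar G$ is the complement of $G$. The join $G\triangledown H$ is the disjoint union of $G$ and $H$ together with all edges between $V(G)$ and $V(H)$. A $k$-path cover of a graph is a set of $k$ vertex-disjoint directed paths in the graph covering all vertices, where single vertices count as (trivial) paths, and a path with at least two vertices traversed in its two opposite directions gives two different directed paths. Let $p_k(G)$ be the number of $k$-path covers of $G$; for a graph with $n$ vertices the signed path-cover polynomial is $\pi_G^+(t)=\sum_{k=1}^n(-1)^{n-k}p_k(G)t^k$. $c(G)$ denotes the number of directed Hamiltonian cycles in a graph $G$ with at least two vertices: the number of cyclic permutations $\sigma$ of $V(G)$ (a single cycle on all vertices) with $v$ and $\sigma(v)$ adjacent for every vertex $v$; in particular $c(K_n)=(n-1)!$ for $n\ge 2$, including $c(K_2)=1$. For polynomials $f,g$ without constant term, $\langle f,g\rangle=\int_0^\infty t^{-1}e^{-t}f(t)g(t)\,dt$. *)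

(* Defs.v *)
(* MathComp / MathComp-Analysis *)
From HB Require Import structures.
From mathcomp Require Import all_boot all_order all_algebra all_fingroup.
From mathcomp Require Import all_classical all_reals all_analysis.

Set Implicit Arguments.
Unset Strict Implicit.
Unset Printing Implicit Defensive.

Import Order.TTheory GRing.Theory Num.Theory.

Local Open Scope ring_scope.

Record sgraph := SGraph {
  vertex :> finType;
  adj : rel vertex;
  adj_sym : symmetric adj;
  adj_irrefl : irreflexive adj;
  vertex_gt0 : (0 < #|vertex|)%N }.

Section Operations.
Variables G H : sgraph.

Definition compl_adj : rel G := [rel x y | (x != y) && ~~ adj x y].

Lemma compl_adj_sym : symmetric compl_adj.
Proof. by move=> x y; rewrite /compl_adj /= eq_sym adj_sym. Qed.

Lemma compl_adj_irrefl : irreflexive compl_adj.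
Proof. by move=> x; rewrite /compl_adj /= eqxx. Qed.

Definition graph_compl : sgraph :=
  SGraph compl_adj_sym compl_adj_irrefl (vertex_gt0 G).

Definition join_adj : rel (G + H)%type := fun u v =>
  match u, v with
  | inl x, inl y => adj x y
  | inr x, inr y => adj x y
  | _, _ => true
  end.

Lemma join_adj_sym : symmetric join_adj.
Proof. by move=> [x|x] [y|y] //=; rewrite adj_sym. Qed.

Lemma join_adj_irrefl : irreflexive join_adj.
Proof. by move=> [x|x] /=; rewrite adj_irrefl. Qed.

Lemma join_vertex_gt0 : (0 < #|{: G + H}|)%N.
Proof. by rewrite card_sum addn_gt0 vertex_gt0. Qed.

Definition graph_join : sgraph :=
  SGraph join_adj_sym join_adj_irrefl join_vertex_gt0.

End Operations.

(* A directed path is the nonempty duplicate-free sequence of its vertices in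
   order of traversal. The bound #|G| on the length of such a sequence always
   holds; it only serves to make the type of candidates finite. *)
Definition is_dipath (G : sgraph) (p : #|G|.-bseq G) : bool :=
  [&& p != [::] :> seq G, uniq p & sorted (@adj G) p].

Definition is_path_cover (G : sgraph) (k : nat) (P : {set #|G|.-bseq G}) :
    bool :=
  [&& #|P| == k,
      [forall p in P, is_dipath p],
      [forall p in P, [forall q in P, (p != q) ==> [disjoint p & q]]] &
      [forall v : G, [exists p in P, v \in p]]].

Definition num_path_covers (G : sgraph) (k : nat) : nat :=
  #|[set P : {set #|G|.-bseq G} | is_path_cover k P]|.

Definition path_cover_poly (R : realType) (G : sgraph) : {poly R} :=
  \sum_(1 <= k < #|G|.+1)
     ((-1) ^+ (#|G| - k) * (num_path_covers G k)%:R) *: 'X^k.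

(* The cyclic permutations of the vertices are those with a single orbit. *)
Definition num_ham_cycles (G : sgraph) : nat :=
  #|[set s : {perm G} | (porbits s == [set [set: G]])
                        && [forall v, adj v (s v)]]|.

(* The integral is kept in the extended reals: a finite value forces the
   integrand to be integrable, whereas the real-valued Rintegral is 0 whenever
   the integral is infinite. *)
Definition pairing (R : realType) (f g : {poly R}) : \bar R :=
  (\int[@lebesgue_measure R]_(t in `]0%R, +oo[%classic)
     (t^-1 * expR (- t) * f.[t] * g.[t])%:E)%E.

(* Main.v *)
Require Import Defs.
From mathcomp Require Import all_boot all_order all_algebra all_fingroup.
From mathcomp Require Import all_classical all_reals all_analysis.
From mathcomp Require Import measurable_realfun ring.
From mathcomp Require Import fintype finset.

(* The complement of the join is the disjoint union U of the two complements,
   which has no Hamiltonian cycle. Inclusion-exclusion over the arcs of U used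
   by a cyclic permutation s gives a signed sum over pairs (s, A), where A is a
   nonempty set of vertices and s follows arcs of U except on entering A. Cutting
   s in front of the vertices of A yields a path cover of U with #|A| paths, and
   each path cover with k paths arises from (k-1)! cyclic permutations. Hence
   c(join) is the sum over the path covers of U of (-1)^(n-k) (k-1)!. A path
   cover of U is a pair of path covers of the parts, and the pairing of t^a and
   t^b is the Gamma integral (a+b-1)!.
   The count (k-1)! comes from closing each path into a cycle: for a permutation
   s of which A meets each cycle once, and r running over the permutations
   supported on A, the number of cycles of r * s is distributed like that of r. *)

Set Implicit Arguments.
Unset Strict Implicit.
Unset Printing Implicit Defensive.

Import Order.TTheory GRing.Theory Num.Theory.
Import numFieldNormedType.Exports.

Local Open Scope ring_scope.

(** * Cycles in a coset of permutations *)

Section Orbits.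
Variable T : finType.
Implicit Types (r s : {perm T}) (A : {set T}) (x y : T).

(** In a product of permutations the left factor acts first, so [r * s] moves a point as [s] does
    wherever [r] fixes it; hence the powers of both agree at [x]. *)
Lemma porbit_mull_fixed r s x :
  {in porbit s x, r =1 id} -> porbit (r * s)%g x = porbit s x.
Proof.
move=> rid.
have eqX i : ((r * s) ^+ i)%g x = (s ^+ i)%g x.
  elim: i => [|i IHi]; first by rewrite !expg0.
  by rewrite !expgSr !permM IHi rid ?mem_porbit.
by apply/setP=> y; apply/porbitP/porbitP => -[i ->]; exists i; rewrite eqX.
Qed.

(* Induction on [A]: for [r] fixing [y], the orbit of [y] avoids the other points
   of [A], so that [tperm x y] merges two orbits of [r * s] when [x != y]. *)
Lemma sum_porbits_perm_on s A : {in A &, injective (porbit s)} ->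
  \sum_(r | perm_on A r) 'X^#|porbits (r * s)%g| * 'X^#|A|
    = 'X^#|porbits s| * \prod_(i < #|A|) ('X + i%:R) :> {poly int}.
Proof.
have [k] := ubnP #|A|; elim: k A => // k IHk A ltAk injA.
have [A0|[y Ay]] := set_0Vmem A.
  rewrite (big_pred1 1%g) => [|r]; last first.
    apply/idP/eqP => [rA|->]; last exact: perm_on1.
    by apply: perm_on_id rA _; rewrite A0 cards0.
  by rewrite mul1g A0 cards0 big_ord0 expr0.
pose B := A :\ y.
have cardA : #|A| = #|B|.+1 by rewrite (cardsD1 y) Ay.
have ltBk : (#|B| < k)%N by move: ltAk; rewrite cardA.
have sBA : B \subset A by apply: subD1set.
have injB : {in B &, injective (porbit s)}.
  by move=> a b Ba Bb; apply: injA; apply: (subsetP sBA).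
have orb_y r : perm_on B r -> porbit (r * s)%g y = porbit s y.
  move=> rB; apply: porbit_mull_fixed => z zy; apply: (out_perm rB).
  apply: contraL (zy) => Bz; have [zNy Az] := setD1P Bz.
  by rewrite -eq_porbit_mem; apply: contra_neqN zNy => /eqP; apply: injA.
(* The sum is split by the point [x] that [r] sends to [y]. Each such [r] is [tperm x y * r'] with
   [r'] supported on [B]. The case [x = y] contributes a factor ['X]; each of the [#|B|] other cases
   contributes 1, since the cycle lost by merging is offset by the extra ['X] in ['X^#|A|]. The
   total is the new factor ['X + #|B|]. *)
rewrite (partition_big (fun r => r^-1 y)%g (mem A)) => [|r rA] /=; last first.
  by rewrite perm_closed ?perm_onV.
have inner x : x \in A ->
    \sum_(r | perm_on A r && ((r^-1)%g y == x)) 'X^#|porbits (r * s)%g| * 'X^#|A|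
    = (if x == y then 'X else 1) *
      \sum_(r | perm_on B r) 'X^#|porbits (r * s)%g| * 'X^#|B| :> {poly int}.
  move=> Ax; have tA : perm_on A (tperm x y).
    by apply: subset_trans (tperm_on x y) _; apply/subsetP=> z /set2P[] ->.
  rewrite (reindex_inj (mulgI (tperm x y))) mulr_sumr /=.
  have cond_eq r : perm_on A (tperm x y * r)%g && (((tperm x y * r)^-1)%g y == x)
      = perm_on B r.
    rewrite invMg tpermV permM; apply/andP/idP => [[rA /eqP rx]|rB].
      have ry : r y = y.
        by rewrite -{1}[y](tpermL x y) -(canRL (tpermK _ _) rx) permKV.
      have r_A : perm_on A r.
        by rewrite -(mulKg (tperm x y) r) tpermV; apply: perm_onM.
      apply/subsetP=> z; rewrite inE => rz; rewrite in_setD1 (subsetP r_A) //.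
      by rewrite andbT; apply: contraNneq rz => ->; rewrite ry.
    split; first by apply: perm_onM => //; apply: subset_trans rB sBA.
    by rewrite (out_perm (perm_onV rB)) ?tpermR // !inE eqxx.
  rewrite (eq_bigl _ _ cond_eq); apply: eq_bigr => r rB; rewrite -mulgA cardA.
  have [-> | xNy] := eqVneq x y; first by rewrite tperm1 mul1g exprS mulrCA.
  have := porbits_mul_tperm (r * s)%g x y; rewrite /= xNy orb_y //.
  rewrite -eq_porbit_mem -(orb_y r) // orb_y // => card_trs.
  have -> : #|porbits (r * s)%g| = #|porbits (tperm x y * (r * s))%g|.+1.
    move: card_trs; case: eqP => [/injA-/(_ Ax Ay)/eqP|_].
      by rewrite (negPf xNy).
    by rewrite addn1 /= addn2 => -[].
  by rewrite mul1r !exprS -mulrA mulrCA.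
rewrite (eq_bigr _ inner) (IHk B) // -mulr_suml cardA big_ord_recr /= mulrCA.
congr (_ * _); rewrite mulrC; congr (_ * _).
rewrite (bigD1 y) //= eqxx; congr (_ + _).
rewrite (eq_bigr (fun=> 1)) => [|x /andP[_ /negPf->]] //.
rewrite sumr_const; congr (_ *+ _); apply: eq_card => x.
by rewrite !inE andbC.
Qed.

End Orbits.

Section Transversals.
Variable T : finType.
Implicit Types (r s : {perm T}) (A : {set T}) (x y : T).

Definition porbit_transversal A s := [forall x, #|A :&: porbit s x| == 1%N].

Lemma porbit_transversalP A s : reflect
  ({in A &, injective (porbit s)} /\ forall x, exists2 a, a \in A & x \in porbit s a)
  (porbit_transversal A s).
Proof.
apply: (iffP forallP) => [trA|[injA meetA] x].
  split=> [a b Aa Ab eq_ab|x].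
    have /cards1P[c Ac] := trA a; have: b \in [set c].
      by rewrite -Ac inE Ab eq_ab porbit_id.
    have: a \in [set c] by rewrite -Ac inE Aa porbit_id.
    by rewrite !inE => /eqP-> /eqP.
  have /cards1P[a Aa] := trA x; have: a \in [set a] by rewrite inE.
  by rewrite -Aa inE porbit_sym => /andP[? ?]; exists a.
have [a Aa ax] := meetA x; apply/cards1P; exists a; apply/setP=> b.
rewrite !inE; apply/andP/eqP => [[Ab bx]|->]; last by rewrite porbit_sym.
apply: injA => //; apply/eqP; move: ax; rewrite -!eq_porbit_mem.
by move: bx; rewrite -eq_porbit_mem => /eqP->.
Qed.

Lemma porbit_transversalV A s :
  porbit_transversal A s^-1%g = porbit_transversal A s.
Proof. by apply: eq_forallb => x; rewrite porbitV. Qed.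

Lemma card_porbits_transversal A s :
  porbit_transversal A s -> #|porbits s| = #|A|.
Proof.
case/porbit_transversalP=> injA meetA; rewrite -(card_in_imset injA).
congr #|pred_of_set _|; apply/eqP; rewrite eqEsubset; apply/andP; split.
  apply/subsetP=> _ /imsetP[x _ ->]; have [a Aa xa] := meetA x.
  by apply/imsetP; exists a => //; apply/eqP; rewrite eq_porbit_mem.
by apply/subsetP=> _ /imsetP[a _ ->]; apply: imset_f.
Qed.

(** Here [s] has [#|A|] orbits, so the powers of ['X] cancel and the rising factorial remains: the
    generating function of the permutations of [A] by number of cycles. *)
Lemma sum_porbits_transversal A s : porbit_transversal A s ->
  \sum_(r | perm_on A r) 'X^#|porbits (r * s)%g|
    = \prod_(i < #|A|) ('X + i%:R) :> {poly int}.
Proof.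
move=> trA; have [injA _] := porbit_transversalP _ _ trA.
have := sum_porbits_perm_on injA.
rewrite -mulr_suml (card_porbits_transversal trA) mulrC.
by apply: mulfI; rewrite monic_neq0 ?monicXn.
Qed.

Lemma card_porbits_coef A s m :
  #|[set r | perm_on A r & #|porbits (r * s)%g| == m]|%:R
    = (\sum_(r | perm_on A r) 'X^#|porbits (r * s)%g| : {poly int})`_m.
Proof.
rewrite coef_sum -sum1_card natr_sum.
rewrite (eq_bigl (fun r => perm_on A r && (#|porbits (r * s)%g| == m))).
  rewrite big_mkcondr; apply: eq_bigr => r _.
  by rewrite coefXn eq_sym; case: eqP.
by move=> r; rewrite inE.
Qed.

(** This is the linear coefficient of the rising factorial: once the factor ['X] is removed, the
    value at 0 is the product of the numbers from 1 to [#|A|.-1]. *)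
Lemma card_cyclic_coset A s : A != set0 -> porbit_transversal A s ->
  #|[set r | perm_on A r & #|porbits (r * s)%g| == 1%N]| = (#|A|.-1)`!.
Proof.
move=> A0 trA; apply/eqP; rewrite -(eqr_nat int) card_porbits_coef.
rewrite sum_porbits_transversal //; have: (0 < #|A|)%N by rewrite card_gt0.
case: #|A| => // k _; rewrite big_ord_recl addr0 coefXM /=.
rewrite -horner_coef0 horner_prod fact_prod big_add1 big_mkord natr_prod.
by apply/eqP; apply: eq_bigr => i _; rewrite -polyC_natr !hornerE.
Qed.

(** The rising factorial is monic of degree [#|A|], so exactly one permutation supported on [A]
    yields [#|A|] cycles; both [1] and [r] do. *)
Lemma transversal_coset_unique A r s : perm_on A r ->
  porbit_transversal A s -> porbit_transversal A (r * s)%g -> r = 1%g.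
Proof.
move=> rA trs trrs.
have: #|[set r | perm_on A r & #|porbits (r * s)%g| == #|A|]| = 1%N.
  apply/eqP; rewrite -(eqr_nat int) card_porbits_coef.
  rewrite sum_porbits_transversal //; apply/eqP.
  rewrite (eq_bigr (fun i : 'I_#|A| => 'X - (- i%:R)%:P)) => [|i _]; last first.
    by rewrite polyCN opprK polyC_natr.
  have /monicP := monic_prod_XsubC (index_enum 'I_#|A|) xpredT
                    (fun i => - i%:R : int).
  by rewrite lead_coefE size_prod_XsubC [index_enum _]unlock -enumT size_enum_ord.
move=> /eqP/cards1P[u Eu].
have: r \in [set u] by rewrite -Eu !inE rA (card_porbits_transversal trrs) eqxx.
have: 1%g \in [set u].
  by rewrite -Eu !inE perm_on1 mul1g (card_porbits_transversal trs) eqxx.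
by rewrite !inE => /eqP-> /eqP.
Qed.

(** An extremal choice: [r] maximizes the number of cycles of [r * s]. A cycle avoiding [A] would be
    the only orbit of [s], which contains [A]; two points of [A] on one cycle could be separated by
    a transposition, giving one more cycle. *)
Lemma exists_transversal_coset A s : #|porbits s| = 1%N -> A != set0 ->
  exists2 r, perm_on A r & porbit_transversal A (r * s)%g.
Proof.
move=> s1 /set0Pn[a0 Aa0].
have meet r x : perm_on A r -> exists2 a, a \in A & a \in porbit (r * s)%g x.
  move=> rA; apply/exists_inP; apply: contraT => /exists_inPn notA.
  have orb_x : porbit s x = porbit (r * s)%g x.
    rewrite -{1}(mulKg r s); apply: porbit_mull_fixed => z zx.
    by rewrite (out_perm (perm_onV rA)) //; apply: contraL zx; apply: notA.
  case/negP: (notA a0 Aa0); rewrite -orb_x.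
  have /eqP/cards1P[B EB] := s1.
  have /set1P a0O : porbit s a0 \in [set B] by rewrite -EB imset_f.
  have /set1P xO : porbit s x \in [set B] by rewrite -EB imset_f.
  by rewrite xO -a0O porbit_id.
have [r rA max_r] := arg_maxnP (fun r => #|porbits (r * s)%g|) (perm_on1 A).
exists r => //; apply/porbit_transversalP; split=> [a b Aa Ab eq_ab|x]; last first.
  by have [a Aa] := meet r x rA; rewrite porbit_sym; exists a.
apply/eqP; apply: contraT => aNb.
have tA : perm_on A (tperm a b).
  by apply: subset_trans (tperm_on a b) _; apply/subsetP=> z /set2P[] ->.
have := porbits_mul_tperm (r * s)%g a b; rewrite /= -eq_porbit_mem eq_ab eqxx aNb.
have := max_r _ (perm_onM tA rA); rewrite -mulgA addn0 addn1 /=.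
by move=> le_r eq_r; move: le_r; rewrite /= eq_r ltnn.
Qed.

(* Every coset of the permutations supported on [A] that contains a cyclic
   permutation contains exactly one permutation with transversal [A]. *)
Lemma card_cyclic_transversal A (X : pred {perm T}) : A != set0 ->
  (forall r s, perm_on A r -> X (r * s)%g = X s) ->
  #|[set s | #|porbits s| == 1%N & X s]|
    = ((#|A|.-1)`! * #|[set s | porbit_transversal A s & X s]|)%N.
Proof.
move=> A0 Xinv.
transitivity (\sum_(s | (#|porbits s| == 1%N) && X s)
   \sum_(r | perm_on A r) porbit_transversal A (r^-1 * s)%g : nat)%N.
  rewrite -sum1_card (eq_bigl (fun s => (#|porbits s| == 1%N) && X s)) => [|s].
    apply: eq_bigr => s /andP[/eqP s1 _].
    have [r rA trrs] := exists_transversal_coset s1 A0.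
    rewrite (bigD1 r^-1%g) ?perm_onV //= invgK trrs big1 // => r' /andP[r'A r'Nr].
    apply/eqP; rewrite eqb0; apply: contra r'Nr => trr's.
    have /eqP : (r'^-1 * r^-1)%g = 1%g.
      apply: (@transversal_coset_unique A _ (r * s)%g) => //.
        by rewrite perm_onM ?perm_onV.
      by rewrite mulgA mulgKV.
    by rewrite -eq_invg_mul invgK.
  by rewrite inE.
rewrite exchange_big /=.
transitivity (\sum_(r | perm_on A r) \sum_(s | porbit_transversal A s && X s)
    (#|porbits (r * s)%g| == 1%N) : nat)%N.
  apply: eq_bigr => r rA; rewrite (reindex_inj (mulgI r)) /=.
  rewrite [LHS]big_mkcond [RHS]big_mkcond; apply: eq_bigr => s _.
  by rewrite Xinv // mulKg; case: (X s); rewrite ?andbF ?andbT //;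
     case: eqP => //; case: (porbit_transversal A s).
rewrite exchange_big -[#|finset _|]sum1_card big_distrr /=.
rewrite [RHS](eq_bigl (fun s => porbit_transversal A s && X s)) => [|s]; last first.
  by rewrite inE.
apply: eq_bigr => s /andP[trs _]; rewrite muln1 -(card_cyclic_coset A0 trs).
rewrite -[RHS]sum1_card big_mkcond [RHS]big_mkcond; apply: eq_bigr => r _.
by rewrite inE; case: (perm_on A r); case: eqP.
Qed.

End Transversals.

(** * Path covers as permutations with a transversal *)

Section PathCovers.
Variables (T : finType) (e : rel T) (m : nat).
Implicit Types (s : {perm T}) (A : {set T}) (P : {set m.-bseq T}) (x y v : T).

(** Requiring exactly one path through each vertex expresses disjointness and covering at once. The
    length bound [m] is a free parameter, so that covers of two graphs and of their union can be
    related. *)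
Definition path_cover P :=
  [forall p in P, [&& p != [::] :> seq T, uniq p & sorted e p]] &&
  [forall v, #|[set p in P | v \in p]| == 1%N].

(* A path cover is encoded by the set of the first vertices of its paths and
   the permutation that closes each path into a cycle. *)
Definition marked_cover (u : {set T} * {perm T}) :=
  porbit_transversal u.1 u.2 && [forall v in ~: u.1, e (u.2^-1 v)%g v].

(** The default of [insub_bseq] for overlong sequences is the empty one; [le_T_m] below excludes
    that case. *)
Definition cut_path s x : m.-bseq T :=
  insub_bseq m (traject s x #|porbit s x|).

Definition cut_paths (u : {set T} * {perm T}) := [set cut_path u.2 x | x in u.1].

Hypothesis le_T_m : (#|T| <= m)%N.

Lemma val_cut_path s x : cut_path s x = traject s x #|porbit s x| :> seq T.
Proof.
by rewrite /cut_path /insub_bseq insubdK // unfold_in size_traject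
           (leq_trans (max_card _)).
Qed.

Lemma cut_path_cons s x : exists q, cut_path s x = x :: q :> seq T.
Proof.
rewrite val_cut_path; have := card_porbit_neq0 s x.
by case: #|_| => // n _; exists (traject s (s x) n).
Qed.

Lemma mem_cut_path s x : cut_path s x =i porbit s x.
Proof. by move=> y; rewrite porbit_traject -val_cut_path. Qed.

Lemma cut_path_inj s s' x x' : cut_path s x = cut_path s' x' ->
  x = x' /\ {in porbit s x, s =1 s'}.
Proof.
move=> eq_cut; have [q Eq] := cut_path_cons s x.
have [q' Eq'] := cut_path_cons s' x'.
have eqx : x = x' by move: Eq; rewrite eq_cut Eq' => -[].
split=> //; rewrite -eqx {q q' Eq Eq' x' eqx} in eq_cut *.
have eq_tr : traject s x #|porbit s x| = traject s' x #|porbit s' x|.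
  by rewrite -!val_cut_path eq_cut.
have eq_size : #|porbit s x| = #|porbit s' x|.
  by rewrite -[LHS](size_traject s x) eq_tr size_traject.
(* The bound is inclusive: the last index is the closing arc, where both iterations return to
   [x]. *)
have eq_iter i : (i <= #|porbit s x|)%N -> iter i s x = iter i s' x.
  rewrite leq_eqVlt => /predU1P[->|lti].
    by rewrite iter_porbit eq_size iter_porbit.
  by rewrite -(nth_traject s lti) eq_tr nth_traject // -eq_size.
move=> y; rewrite porbit_traject => /trajectP[i lti ->].
by rewrite -iterS eq_iter // iterS eq_iter // ltnW.
Qed.

Lemma path_cover_cut_paths u : marked_cover u -> path_cover (cut_paths u).
Proof.
case: u => A s /andP[/= /porbit_transversalP[injA meetA] /forall_inP eA].
apply/andP; split.
  apply/forall_inP=> _ /imsetP[x Ax ->]; have [q Eq] := cut_path_cons s x.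
  apply/and3P; split; first by rewrite Eq.
    by rewrite val_cut_path uniq_traject_porbit.
  rewrite val_cut_path {q Eq}.
  have := uniq_traject_porbit s x; have := porbit_traject s x.
  case: #|porbit s x| => // n; rewrite trajectS => orb_x uniq_x.
  apply/(pathP x) => i; rewrite size_traject => lt_in.
  rewrite -trajectS nth_traject; last exact: ltnW.
  rewrite (set_nth_default (s x)) ?size_traject // nth_traject // -iterSr iterS.
  (* The arc belongs to [e] unless its end lies in [A]. In that case the end, being on the orbit of
     [x], would be [x] itself, and [x] would occur twice in the trajectory. *)
  rewrite -{1}(permK s (iter i s x)); apply: eA.
  rewrite inE; apply/negP => Av.
  have orb_v : s (iter i s x) \in porbit s x.
    by rewrite -iterS orb_x -trajectS; apply/trajectP; exists i.+1.
  have /(injA _ _ Av Ax) : porbit s (s (iter i s x)) = porbit s x.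
    by apply/eqP; rewrite eq_porbit_mem.
  move=> iter_x.
  have := @nth_uniq _ x (traject s x n.+1) i.+1 0%N.
  by rewrite size_traject nth_traject // iterS iter_x eqxx => /(_ lt_in isT uniq_x).
apply/forallP=> v; have [a Aa va] := meetA v; apply/cards1P; exists (cut_path s a).
apply/setP=> p; rewrite !inE; apply/andP/eqP => [[/imsetP[b Ab ->]]|->].
  rewrite mem_cut_path -eq_porbit_mem => /eqP /= vb; congr (cut_path s _).
  by apply: injA => //; rewrite -vb; apply/eqP; rewrite eq_porbit_mem.
by rewrite mem_cut_path imset_f.
Qed.

Lemma cut_paths_inj : {in marked_cover &, injective cut_paths}.
Proof.
have sub A A' s s' : cut_paths (A, s) = cut_paths (A', s') -> A \subset A'.
  move=> eq_cut; apply/subsetP=> x Ax.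
  have: cut_path s x \in cut_paths (A', s') by rewrite -eq_cut imset_f.
  by case/imsetP=> x' A'x' /cut_path_inj[->].
move=> [A s] [A' s'] Ds _ eq_cut; have eqA : A = A'.
  by apply/eqP; rewrite eqEsubset !(sub _ _ _ _ eq_cut, sub _ _ _ _ (esym eq_cut)).
congr pair => //; apply/permP=> y.
have /andP[/= /porbit_transversalP[_ meetA] _] := Ds.
have [a Aa ya] := meetA y.
have: cut_path s a \in cut_paths (A', s') by rewrite -eq_cut imset_f.
by case/imsetP=> x' A'x' /cut_path_inj[_]; apply.
Qed.

Lemma card_cut_paths u : #|cut_paths u| = #|u.1|.
Proof. by apply: card_imset => x y /cut_path_inj[]. Qed.

(** The preimage consists of the heads of the paths and of the permutation moving each vertex one
    step along its path; [next] wraps around, so it sends the last vertex back to the head. *)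
Lemma cut_paths_onto P : path_cover P -> exists2 u, marked_cover u & cut_paths u = P.
Proof.
case/andP=> /forall_inP pathP /forallP coverP.
have mem_bseq (p : m.-bseq T) v : (v \in p) = (v \in (p : seq T)) by [].
have /fin_all_exists[pp ppP] v : exists p, [set q in P | v \in q] = [set p].
  exact/cards1P.
have pp_uniq p v : p \in P -> v \in p -> p = pp v.
  by move=> Pp pv; apply/set1P; rewrite -ppP inE Pp.
have Ppp v : pp v \in P by have := set11 (pp v); rewrite -ppP inE => /andP[].
have mem_pp v : v \in pp v by have := set11 (pp v); rewrite -ppP inE => /andP[].
have pp_next v : pp (next (pp v) v) = pp v.
  by apply/esym/pp_uniq; rewrite ?mem_next.
have next_inj : injective (fun v => next (pp v) v).
  move=> v w eq_next; have eq_pp : pp v = pp w by rewrite -pp_next eq_next pp_next.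
  have /and3P[_ Uv _] := pathP _ (Ppp v).
  by apply: (can_inj (prev_next Uv)); rewrite eq_next eq_pp.
pose s := perm next_inj.
have cyc_s p : p \in P -> fcycle s p.
  move=> Pp; have /and3P[_ Up _] := pathP p Pp.
  rewrite (@eq_in_cycle _ (mem p) _ (frel (next p))) ?cycle_next ?allss //.
  by move=> x y px py /=; rewrite permE /= -(pp_uniq p x).
have traj_s p x q : p \in P -> p = x :: q :> seq T ->
    x :: q = traject s x #|porbit s x| /\ porbit s x =i p.
  move=> Pp Ep; have := cyc_s p Pp; rewrite Ep /= rcons_path => /andP[/fpathE Eq _].
  have Exq : x :: q = traject s x (size q).+1 by rewrite trajectS -Eq.
  have orb : porbit s x =i p.
    move=> y; apply/porbitP/idP => [[i ->]|].
      elim: i => [|i IHi]; first by rewrite perm1 mem_bseq Ep mem_head.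
      by rewrite expgSr permM permE /= -(pp_uniq p _ Pp IHi) mem_next.
    rewrite mem_bseq Ep Exq => /trajectP[i _ ->]; exists i.
    by rewrite permX.
  have /and3P[_ Up _] := pathP p Pp.
  by split=> //; rewrite (eq_card orb) (card_uniqP Up) Ep.
pose A := [set v | v == head v (pp v)].
have headP v : exists x q, pp v = x :: q :> seq T.
  have /and3P[] := pathP _ (Ppp v).
  by case: (pp v) => -[|x q] //= _ _ _; exists x, q.
have pp_head x q v : pp v = x :: q :> seq T -> pp x = pp v.
  by move=> Ev; apply/esym/pp_uniq; rewrite // mem_bseq Ev mem_head.
have A_head x q v : pp v = x :: q :> seq T -> x \in A.
  by move=> Ev; rewrite inE (pp_head _ _ _ Ev) Ev.
have headA x : x \in A -> exists q, pp x = x :: q :> seq T.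
  by rewrite inE; have [y [q ->]] := headP x => /= /eqP <-; exists q.
exists (A, s).
  apply/andP; split=> /=.
    apply/porbit_transversalP; split=> [a b Aa Ab eq_ab|v].
      have [qa Ea] := headA a Aa; have [qb Eb] := headA b Ab.
      have [_ orb_b] := traj_s _ _ _ (Ppp b) Eb.
      have : a \in pp b by rewrite -orb_b -eq_ab porbit_id.
      by move/(pp_uniq _ _ (Ppp b)) => eq_pp; move: Eb; rewrite eq_pp Ea => -[].
    have [x [q Ev]] := headP v; exists x; first exact: A_head Ev.
    by have [_ ->] := traj_s _ _ _ (Ppp v) Ev.
  (* A vertex that is not a head has a predecessor in its path. Splitting the path at [v] exhibits
     the arc into [v] both as an arc of [e] and as a step of [s]. *)
  apply/forall_inP=> v; rewrite !inE; have [x [q Ev]] := headP v.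
  rewrite Ev /= => vNx; have := mem_pp v.
  rewrite mem_bseq Ev inE (negPf vNx) /= => qv.
  have := cyc_s _ (Ppp v); have /and3P[_ _] := pathP _ (Ppp v); rewrite Ev /=.
  case/splitPr: qv => q1 q2; rewrite cat_path rcons_path cat_path /=.
  case/and3P=> _ e_v _ /andP[/and3P[_ /eqP s_v _] _].
  by rewrite -s_v permK s_v.
apply/setP=> p; apply/imsetP/idP => [[x Ax ->]|Pp] /=.
  have [q Ex] := headA x Ax; have [Et _] := traj_s _ _ _ (Ppp x) Ex.
  suff -> : cut_path s x = pp x by [].
  by apply: val_inj; rewrite /= val_cut_path Ex.
have /and3P[] := pathP p Pp; case Ep: (bseqval p) => [|x q] // _ _ _.
have Epp : pp x = x :: q :> seq T by rewrite -(pp_uniq p) // mem_bseq Ep mem_head.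
exists x; first exact: A_head Epp.
by apply: val_inj; rewrite /= val_cut_path Ep; have [] := traj_s _ _ _ Pp Ep.
Qed.

Lemma card_path_cover P : (0 < #|T|)%N -> path_cover P -> (0 < #|P| <= #|T|)%N.
Proof.
case/card_gt0P=> x _ /cut_paths_onto[[A s] + <-].
case/andP=> /= /porbit_transversalP[_ meetA] _.
rewrite card_cut_paths /= max_card andbT card_gt0; apply/set0Pn.
by have [a Aa _] := meetA x; exists a.
Qed.

Lemma path_cover_sum (M : nmodType) (f : nat -> M) :
  \sum_(P | path_cover P) f #|P|
    = \sum_A \sum_(s | porbit_transversal A s && [forall v in ~: A, e (s^-1 v)%g v])
        f #|A|.
Proof.
rewrite pair_big_dep /=.
rewrite (eq_bigl (mem (cut_paths @: marked_cover))) => [|P].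
  rewrite big_imset /=; last exact: cut_paths_inj.
  by apply: eq_bigr => u _; rewrite card_cut_paths.
apply/idP/imsetP=> [/cut_paths_onto[u Du <-]|[u Du ->]]; first by exists u.
exact: path_cover_cut_paths.
Qed.

End PathCovers.

(** * Inclusion-exclusion and disjoint unions *)

Section CyclicAvoidance.
Variables (R : comNzRingType) (T : finType) (e : rel T).

(** The indicator of avoiding [e] is the product over [v] of [1 - e v (s v)]. In its expansion, [A]
    is the set of vertices at which the term 1 is chosen. *)
Lemma card_cyclic_avoid :
  #|[set s : {perm T} | #|porbits s| == 1%N & [forall v, ~~ e v (s v)]]|%:R
  = \sum_(A : {set T}) (-1) ^+ #|~: A|
      * #|[set s : {perm T} | #|porbits s| == 1%N
                              & [forall v in ~: A, e v (s v)]]|%:R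
  :> R.
Proof.
have nat_card (X : pred {perm T}) :
    #|[set s : {perm T} | #|porbits s| == 1%N & X s]|%:R
    = \sum_(s | #|porbits s| == 1%N) (X s)%:R :> R.
  rewrite -sum1_card natr_sum (eq_bigl (fun s => (#|porbits s| == 1%N) && X s)).
    by rewrite big_mkcondr; apply: eq_bigr => s _; case: (X s).
  by move=> s; rewrite inE.
have nat_forall (A : {set T}) (b : pred T) :
    [forall v in A, b v]%:R = \prod_v (if v \in ~: A then 1 else (b v)%:R) :> R.
  have [/forall_inP bA|] := boolP [forall v in A, b v].
    by rewrite big1 // => v _; rewrite inE; case: ifPn => // /negPn/bA->.
  case/forall_inPn=> v Av /negPf bv; rewrite (bigD1 v) //= inE Av bv.
  by rewrite mul0r.
rewrite nat_card; under [RHS]eq_bigr => A _ do rewrite nat_card mulr_sumr.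
rewrite exchange_big; apply: eq_bigr => s _ /=.
have -> : [forall v, ~~ e v (s v)]%:R = \prod_v (1 - (e v (s v))%:R) :> R.
  have [/forallP es|/forallPn[v /negPn esv]] := boolP [forall v, ~~ e v (s v)].
    by rewrite big1 // => v _; rewrite (negPf (es v)) subr0.
  by rewrite (bigD1 v) //= esv subrr mul0r.
rewrite bigA_distr; apply: eq_bigr => A _; rewrite nat_forall setCK.
rewrite -prodr_const [X in X * _]big_mkcond -big_split; apply: eq_bigr => v _ /=.
by rewrite inE; case: (v \in A); rewrite ?mul1r ?mulN1r.
Qed.

Lemma card_cyclic_avoid_path_covers m : symmetric e -> (0 < #|T|)%N ->
    (#|T| <= m)%N ->
    (forall s : {perm T}, #|porbits s| == 1%N -> ~~ [forall v, e v (s v)]) ->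
  #|[set s : {perm T} | #|porbits s| == 1%N & [forall v, ~~ e v (s v)]]|%:R
  = \sum_(P : {set m.-bseq T} | path_cover e P)
      (-1) ^+ (#|T| - #|P|) * (#|P|.-1)`!%:R :> R.
Proof.
move=> e_sym T_gt0 leTm no_cycle.
pose f k : R := (-1) ^+ (#|T| - k) * (k.-1)`!%:R.
rewrite card_cyclic_avoid (path_cover_sum e leTm f); apply: eq_bigr => A _.
(* Inclusion-exclusion constrains the arcs leaving the vertices outside [A], marked covers those
   entering them; inversion together with the symmetry of [e] exchanges the two. *)
rewrite (reindex_inj invg_inj) /f /=.
rewrite (eq_bigl [in [set s | porbit_transversal A s &
                            [forall v in ~: A, e v (s v)]]]); last first.
  move=> s; rewrite inE porbit_transversalV; congr andb.
  by apply: eq_forallb => v; rewrite invgK e_sym.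
rewrite sumr_const -[RHS]mulr_natr -mulrA -natrM cardsCs setCK.
have [->|A0] := eqVneq A set0; last first.
  rewrite (card_cyclic_transversal A0) // => r s rA; apply: eq_forallb_in => v.
  by rewrite inE permM => /(out_perm rA)->.
(* For empty [A] both counts vanish: the first by [no_cycle], the second because an empty
   transversal leaves no orbit although [T] is nonempty. *)
congr (_ * _%:R); rewrite !(eq_card0 (A := finset _)) ?muln0 // => s;
  rewrite !inE //.
  apply/negP=> /andP[/no_cycle/negP s_e /forall_inP es]; case: s_e.
  apply/forallP=> v.
  by apply: es; rewrite !inE.
apply: contraTF T_gt0 => /andP[/card_porbits_transversal]; rewrite cards0 => s0 _.
rewrite -eqn0Ngt; apply/eqP/eq_card0 => x.
have: porbit s x \in porbits s by apply: imset_f.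
by rewrite (cards0_eq s0) inE.
Qed.

End CyclicAvoidance.

(** * Path covers along an embedding onto a union of components *)

Section EmbedPaths.
Variables (T1 T : finType) (e1 : rel T1) (e : rel T) (f : T1 -> T) (m1 m : nat).
Hypotheses (f_inj : injective f) (f_mono : {mono f : x y / e1 x y >-> e x y}).
Hypothesis f_closed : forall x y, e x y -> (x \in codom f) = (y \in codom f).
Hypotheses (le_T_m1 : (#|T1| <= m1)%N) (le_m1_m : (m1 <= m)%N).

Definition embed_path (p : m1.-bseq T1) : m.-bseq T := insub_bseq m (map f p).

Lemma val_embed_path p : embed_path p = map f p :> seq T.
Proof.
by rewrite /embed_path /insub_bseq insubdK // unfold_in size_map
           (leq_trans (size_bseq p)).
Qed.

Lemma mem_embed_path p x : (f x \in embed_path p) = (x \in p).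
Proof. by rewrite -(mem_map f_inj) -val_embed_path. Qed.

Lemma embed_path_inj : injective embed_path.
Proof.
move=> p q eq_pq; apply/val_inj/(inj_map f_inj).
by rewrite -!val_embed_path eq_pq.
Qed.

Lemma embed_path_dipath p :
  [&& embed_path p != [::] :> seq T, uniq (embed_path p) & sorted e (embed_path p)]
  = [&& p != [::] :> seq T1, uniq p & sorted e1 p].
Proof.
rewrite val_embed_path map_inj_uniq // sorted_map.
rewrite (eq_sorted (e' := e1)); last by move=> x y; rewrite /= f_mono.
by case: (bseqval p).
Qed.

(** By [f_closed] no arc leaves or enters the image of [f], so a path meeting the image stays inside
    it and lifts. The lift has distinct vertices, whence the bound on its length. *)
Lemma embed_path_onto (q : m.-bseq T) x : uniq q -> sorted e q -> f x \in q ->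
  exists p, q = embed_path p.
Proof.
move=> Uq eq qx.
have codom_q y : y \in (q : seq T) -> y \in codom f.
  have {}qx : f x \in (q : seq T) by [].
  have fx := codom_f f x.
  case Eq: (bseqval q) qx eq => [|z s] //= qx path_s.
  have codom_s w : w \in z :: s -> (w \in codom f) = (z \in codom f).
    elim: s z path_s {qx Eq} => [|t s IHs] z /=; first by rewrite inE => _ /eqP->.
    case/andP=> /f_closed zt /IHs{}IHs; rewrite inE => /predU1P[->//|/IHs->].
    by rewrite zt.
  by move=> /codom_s->; rewrite -(codom_s _ qx).
have [s Es] : exists s, q = map f s :> seq T.
  elim: (bseqval q) codom_q => [|y s IHs] codom_s; first by exists [::].
  have [|t ->] := IHs; first by move=> z sz; rewrite codom_s // inE sz orbT.
  by have /codomP[z ->] := codom_s y (mem_head y s); exists (z :: t).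
have size_s : (size s <= m1)%N.
  apply: leq_trans le_T_m1; have: uniq s by rewrite -(map_inj_uniq f_inj) -Es.
  by move/card_uniqP<-; apply: max_card.
by exists (Bseq size_s); apply: val_inj; rewrite /= val_embed_path.
Qed.

Lemma path_cover_preim_embed (P : {set m.-bseq T}) :
  path_cover e P -> path_cover e1 (embed_path @^-1: P).
Proof.
case/andP=> /forall_inP pathP /forallP coverP; apply/andP; split.
  by apply/forall_inP=> p; rewrite inE => /pathP; rewrite embed_path_dipath.
apply/forallP=> x; have /cards1P[q Eq] := coverP (f x).
have: q \in [set q] by rewrite set11.
rewrite -Eq inE => /andP[Pq qx]; have /and3P[_ Uq eq] := pathP q Pq.
have [p Ep] := embed_path_onto Uq eq qx; apply/cards1P; exists p.
apply/setP=> r; rewrite !inE -mem_embed_path.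
have := in_set1 (embed_path r) q; rewrite -Eq inE => ->.
by rewrite Ep (inj_eq embed_path_inj).
Qed.

End EmbedPaths.

(** * Covers of a disjoint union as pairs of covers of its parts *)

Section DisjointUnion.
Variables (T1 T2 : finType) (e1 : rel T1) (e2 : rel T2) (m1 m2 m : nat).
Hypotheses (le_T1 : (#|T1| <= m1)%N) (le_T2 : (#|T2| <= m2)%N).
Hypotheses (le_m1 : (m1 <= m)%N) (le_m2 : (m2 <= m)%N).

Definition sum_rel : rel (T1 + T2)%type := fun u v =>
  match u, v with
  | inl x, inl y => e1 x y
  | inr x, inr y => e2 x y
  | _, _ => false
  end.

Let emb1 := embed_path inl m : m1.-bseq T1 -> m.-bseq (T1 + T2)%type.
Let emb2 := embed_path inr m : m2.-bseq T2 -> m.-bseq (T1 + T2)%type.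
Let inl_inj : injective (@inl T1 T2). Proof. by move=> x y []. Qed.
Let inr_inj : injective (@inr T1 T2). Proof. by move=> x y []. Qed.
Let inl_mono : {mono @inl T1 T2 : x y / e1 x y >-> sum_rel x y}. Proof. by []. Qed.
Let inr_mono : {mono @inr T1 T2 : x y / e2 x y >-> sum_rel x y}. Proof. by []. Qed.

Let codom_inl u : (u \in codom (@inl T1 T2)) = if u is inl _ then true else false.
Proof. by case: u => x; [rewrite codom_f | apply/codomP=> -[]]. Qed.
Let codom_inr u : (u \in codom (@inr T1 T2)) = if u is inr _ then true else false.
Proof. by case: u => x; [apply/codomP=> -[] | rewrite codom_f]. Qed.

Let inl_closed u v : sum_rel u v ->
  (u \in codom (@inl T1 T2)) = (v \in codom (@inl T1 T2)).
Proof. by rewrite !codom_inl; case: u v => x [y|y]. Qed.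
Let inr_closed u v : sum_rel u v ->
  (u \in codom (@inr T1 T2)) = (v \in codom (@inr T1 T2)).
Proof. by rewrite !codom_inr; case: u v => x [y|y]. Qed.

Let inr_emb1 p x : (inr x \in emb1 p) = false.
Proof.
have -> : (inr x \in emb1 p) = (inr x \in map (@inl T1 T2) p).
  by rewrite -(val_embed_path inl le_m1).
by apply/mapP=> -[].
Qed.
Let inl_emb2 p x : (inl x \in emb2 p) = false.
Proof.
have -> : (inl x \in emb2 p) = (inl x \in map (@inr T1 T2) p).
  by rewrite -(val_embed_path inr le_m2).
by apply/mapP=> -[].
Qed.

Definition cover_union (P : {set m1.-bseq T1} * {set m2.-bseq T2}) :=
  (emb1 @: P.1) :|: (emb2 @: P.2).
Definition cover_split (P : {set m.-bseq (T1 + T2)%type}) :=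
  (emb1 @^-1: P, emb2 @^-1: P).

(** Every path of the cover is nonempty, and its first vertex decides in which part the whole path
    lies. *)
Lemma cover_splitK P : path_cover sum_rel P -> cover_union (cover_split P) = P.
Proof.
case/andP=> /forall_inP pathP _; apply/setP=> q; rewrite inE.
apply/orP/idP => [[] /imsetP[p] + ->|Pq]; try by rewrite inE.
have /and3P[] := pathP q Pq; case Eq: (bseqval q) => [|u s] // _ Uq eq.
have qu : u \in q by have: u \in bseqval q by rewrite Eq mem_head.
rewrite -Eq in Uq eq; case: u qu {Eq} => x qx; [left|right].
  have [p Ep] := embed_path_onto inl_inj inl_closed le_T1 le_m1 Uq eq qx.
  by apply/imsetP; exists p; rewrite // inE /emb1 -Ep.
have [p Ep] := embed_path_onto inr_inj inr_closed le_T2 le_m2 Uq eq qx.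
by apply/imsetP; exists p; rewrite // inE /emb2 -Ep.
Qed.

Lemma path_cover_split P : path_cover sum_rel P ->
  path_cover e1 (cover_split P).1 && path_cover e2 (cover_split P).2.
Proof.
move=> coverP; apply/andP; split.
  exact: path_cover_preim_embed inl_inj inl_mono inl_closed le_T1 le_m1 _ coverP.
exact: path_cover_preim_embed inr_inj inr_mono inr_closed le_T2 le_m2 _ coverP.
Qed.

(** Only the empty sequence lies in both images. Covers never contain it, so the two halves of
    [cover_union] are disjoint and can be recovered. *)
Let emb12 p q : emb1 p = emb2 q ->
  p = [::] :> seq T1 /\ q = [::] :> seq T2.
Proof.
move=> eq_pq; have: map inl p = map inr q :> seq (T1 + T2)%type.
  by rewrite -(val_embed_path inl le_m1) -(val_embed_path inr le_m2) -/emb1 eq_pq.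
by case: (bseqval p) (bseqval q) => [|x s] [|y t].
Qed.

Let cover_nil (T' : finType) (e' : rel T') m' (P : {set m'.-bseq T'})
    (p : m'.-bseq T') :
  path_cover e' P -> p \in P -> p != [::] :> seq T'.
Proof. by case/andP=> /forall_inP pathP _ /pathP/and3P[]. Qed.

Lemma cover_unionK P : path_cover e1 P.1 -> path_cover e2 P.2 ->
  cover_split (cover_union P) = P.
Proof.
case: P => P1 P2 /= cover1 cover2; congr pair; apply/setP=> p; rewrite !inE.
  rewrite mem_imset; last exact: embed_path_inj.
  case: (p \in P1) => //=; apply/imsetP=> -[q P2q /emb12[_ q0]].
  by have := cover_nil cover2 P2q; rewrite q0.
rewrite orbC mem_imset; last exact: embed_path_inj.
case: (p \in P2) => //=; apply/imsetP=> -[q P1q /esym/emb12[q0 _]].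
by have := cover_nil cover1 P1q; rewrite q0.
Qed.

Lemma card_cover_union P : path_cover e1 P.1 -> path_cover e2 P.2 ->
  #|cover_union P| = (#|P.1| + #|P.2|)%N.
Proof.
move=> cover1 cover2; rewrite cardsU disjoint_setI0 ?cards0 ?subn0.
  by rewrite !card_imset //; apply: embed_path_inj.
rewrite disjoint_subset; apply/subsetP=> _ /imsetP[p P1p ->]; rewrite inE.
apply/imsetP=> -[q _ /emb12[p0 _]].
by have := cover_nil cover1 P1p; rewrite p0.
Qed.

Lemma path_cover_union P : path_cover e1 P.1 -> path_cover e2 P.2 ->
  path_cover sum_rel (cover_union P).
Proof.
case/andP=> /forall_inP path1 /forallP cover1.
case/andP=> /forall_inP path2 /forallP cover2; apply/andP; split.
  apply/forall_inP=> q; rewrite inE => /orP[] /imsetP[p Pp ->].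
    by rewrite (embed_path_dipath inl_inj inl_mono le_m1) path1.
  by rewrite (embed_path_dipath inr_inj inr_mono le_m2) path2.
apply/forallP=> -[x|x].
  rewrite -(eqP (cover1 x)) -(card_imset _ (embed_path_inj inl_inj le_m1)).
  apply/eqP/eq_card => q; rewrite !inE; apply/andP/imsetP.
    case=> /orP[] /imsetP[p Pp ->]; last by rewrite inl_emb2.
    by rewrite mem_embed_path // => px; exists p; rewrite // inE Pp.
  case=> p; rewrite inE => /andP[Pp px] ->.
  by rewrite mem_embed_path // imset_f.
rewrite -(eqP (cover2 x)) -(card_imset _ (embed_path_inj inr_inj le_m2)).
apply/eqP/eq_card => q; rewrite !inE; apply/andP/imsetP.
  case=> /orP[] /imsetP[p Pp ->]; first by rewrite inr_emb1.
  by rewrite mem_embed_path // => px; exists p; rewrite // inE Pp.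
case=> p; rewrite inE => /andP[Pp px] ->.
by rewrite mem_embed_path // imset_f ?orbT.
Qed.

Lemma path_cover_sum_rel (M : nmodType) (F : nat -> M) :
  \sum_(P : {set m.-bseq (T1 + T2)%type} | path_cover sum_rel P) F #|P|
  = \sum_(P1 : {set m1.-bseq T1} | path_cover e1 P1)
      \sum_(P2 : {set m2.-bseq T2} | path_cover e2 P2) F (#|P1| + #|P2|)%N.
Proof.
rewrite pair_big /= (reindex_onto cover_union cover_split) => [|P]; last first.
  exact: cover_splitK.
apply: eq_big => [P|P /andP[coverP /eqP splitP]].
  apply/andP/andP=> [[coverP /eqP splitP]|[cover1 cover2]].
    by apply/andP; rewrite -splitP path_cover_split.
  by rewrite path_cover_union // cover_unionK.
have /andP[cover1 cover2] := path_cover_split coverP.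
by rewrite splitP in cover1 cover2; rewrite card_cover_union.
Qed.

End DisjointUnion.

(** * The Gamma integral *)

Section GammaIntegral.
Local Open Scope classical_set_scope.
Variable R : realType.
Notation mu := (@lebesgue_measure R).

Lemma cvgry_exprM_expRN n : x ^+ n * expR (- x) @[x --> +oo] --> (0 : R).
Proof.
apply/cvgrPdist_le => d d0; near=> x.
have x0 : 0 < x by near: x; apply: nbhs_pinfty_gt; rewrite num_real.
rewrite sub0r normrN ger0_norm ?mulr_ge0 ?expR_ge0 ?exprn_ge0 ?(ltW x0) //.
have le_exp : x ^+ n.+1 / n.+1`!%:R <= expR x.
  by apply: le_trans (expR_ge1Dxn n (ltW x0)); rewrite lerDr.
rewrite expRN ler_pdivrMr ?expR_gt0 //; apply: le_trans (ler_wpM2l (ltW d0) le_exp).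
rewrite mulrA ler_pdivlMr ?ltr0n ?fact_gt0 // exprSr mulrCA.
rewrite ler_wpM2l ?exprn_ge0 ?(ltW x0) // mulrC -ler_pdivrMr //.
Unshelve. all: by end_near. Qed.

(* The antiderivative of [x ^+ n * expR (- x)] is
   [- (gamma_poly n).[x] * expR (- x)]. *)
Fixpoint gamma_poly n : {poly R} :=
  if n is k.+1 then 'X^n + n%:R *: gamma_poly k else 1.

Lemma gamma_polyE n : gamma_poly n - (gamma_poly n)^`() = 'X^n.
Proof.
elim: n => [|n IHn]; first by rewrite /= derivC subr0 expr0.
rewrite [gamma_poly _]/= derivD derivXn derivZ
  -[X in _ - (X + _)]scaler_nat -scalerDr /= -IHn subrK.
by rewrite addrK.
Qed.

Lemma gamma_poly0 n : (gamma_poly n).[0] = n`!%:R.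
Proof.
elim: n => [|n IHn] /=; first by rewrite hornerC.
by rewrite !hornerE IHn exprS mul0r add0r factS natrM.
Qed.

Lemma cvgry_gamma_poly_expRN n :
  (gamma_poly n).[x] * expR (- x) @[x --> +oo] --> (0 : R).
Proof.
elim: n => [|n IHn] /=.
  by under eq_fun do rewrite hornerC mul1r; exact: cvgr_expR.
under eq_fun do rewrite hornerD hornerXn hornerZ mulrDl -mulrA.
have := cvgD (cvgry_exprM_expRN n.+1) (cvgM (cvg_cst (n.+1%:R : R)) IHn).
by rewrite mulr0 addr0; apply.
Qed.

Lemma continuous_expRN : continuous (fun x : R => expR (- x)).
Proof.
move=> x; apply: continuous_comp; first exact: opp_continuous.
exact: continuous_expR.
Qed.

Lemma continuous_exprM_expRN n : continuous (fun x : R => x ^+ n * expR (- x)).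
Proof.
by move=> x; apply: cvgM; [exact: exprn_continuous | exact: continuous_expRN].
Qed.

Lemma is_derive_gamma n (x : R) :
  is_derive x 1 (fun t => - ((gamma_poly n).[t] * expR (- t))) (x ^+ n * expR (- x)).
Proof.
have dE : is_derive x 1 (fun t : R => expR (- t)) (- expR (- x)).
  by rewrite -mulrN1; exact: (is_derive1_comp (f := expR) (g := -%R)).
apply: is_derive_eq.
rewrite -(hornerXn x n) -gamma_polyE !hornerE /= /GRing.scale /=; ring.
Qed.

Lemma integral_exprM_expRN n :
  (\int[mu]_(t in `]0%R, +oo[) (t ^+ n * expR (- t))%:E = (n`!%:R)%:E)%E.
Proof.
have cont := @continuous_exprM_expRN n.
rewrite integral_itv_obnd_cbnd; last first.
  apply/measurable_EFinP/measurable_funTS.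
  exact: continuous_measurable_fun.
rewrite (@ge0_continuous_FTC2y _ _
  (fun t => - ((gamma_poly n).[t] * expR (- t))) _ 0).
- by rewrite oppr0 expR0 mulr1 gamma_poly0 EFinN oppeK add0e.
- by move=> x x0; rewrite mulr_ge0 ?exprn_ge0 ?expR_ge0.
- exact: continuous_subspaceT.
- by rewrite -oppr0; apply: cvgN; exact: cvgry_gamma_poly_expRN.
- by move=> x _; have [] := is_derive_gamma n x.
- apply: cvg_at_right_filter; apply: cvgN; apply: cvgM.
    exact: continuous_horner.
  exact: continuous_expRN.
- by move=> x _; rewrite derive1E; have [_ ->] := is_derive_gamma n x.
Qed.

(** Integrability allows the pairing, whose terms carry signs, to be split into a sum of
    integrals. *)
Lemma integrable_exprM_expRN n :
  mu.-integrable `]0%R, +oo[ (fun t => (t ^+ n * expR (- t))%:E).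
Proof.
apply/integrableP; split.
  apply/measurable_EFinP/measurable_funTS.
  by apply: continuous_measurable_fun; exact: continuous_exprM_expRN.
suff -> : (\int[mu]_(t in `]0%R, +oo[) `|(t ^+ n * expR (- t))%:E| = (n`!%:R)%:E)%E.
  by rewrite ltry.
rewrite -integral_exprM_expRN; apply: eq_integral => t.
rewrite in_setE /= in_itv /= andbT => t0; congr EFin.
by rewrite ger0_norm // mulr_ge0 ?exprn_ge0 ?expR_ge0 ?(ltW t0).
Qed.

Lemma pairing_sum (I J : finType) (P : pred I) (Q : pred J)
    (c : I -> R) (d : J -> R) (a : I -> nat) (b : J -> nat) :
  (forall i, P i -> (0 < a i)%N) ->
  pairing (\sum_(i | P i) c i *: 'X^(a i)) (\sum_(j | Q j) d j *: 'X^(b j))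
  = (\sum_(i | P i) \sum_(j | Q j) c i * d j * ((a i + b j).-1)`!%:R)%:E.
Proof.
move=> a_gt0; rewrite pair_big /= /pairing.
under eq_integral => t.
  rewrite in_setE /= in_itv /= andbT => t0.
  rewrite !horner_sum -mulrA mulr_suml.
  under eq_bigr do rewrite mulr_sumr.
  rewrite pair_big mulr_sumr -sumEFin.
  under eq_bigr => u /andP[Pu _].
    have -> : t^-1 * expR (- t)
          * ((c u.1 *: 'X^(a u.1)).[t] * (d u.2 *: 'X^(b u.2)).[t])
        = c u.1 * d u.2 * (t ^+ (a u.1 + b u.2).-1 * expR (- t)).
      (* As [a u.1] is positive, [t^-1] cancels one factor [t], and the truncated predecessor in the
         exponent is the true one. *)
      have := a_gt0 _ Pu; case: (a u.1) => // k _.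
      rewrite !hornerE addSn /= exprS exprD; field.
      by rewrite gt_eqF.
    rewrite EFinM.
    over.
  over.
pose F (u : I * J) (t : R) := ((c u.1 * d u.2)%:E *
  (t ^+ (a u.1 + b u.2).-1 * expR (- t))%:E)%E.
rewrite (@integral_sum _ _ _ mu _ _ _ F) //= => [|u].
  rewrite -sumEFin; apply: eq_bigr => u _; rewrite /F.
  rewrite integralZl //; last exact: integrable_exprM_expRN.
  by rewrite integral_exprM_expRN -EFinM.
by apply: integrableZl => //; exact: integrable_exprM_expRN.
Qed.

End GammaIntegral.

(** * Complements and joins of graphs *)

(** Covering gives at least one path through each vertex and disjointness at most one; conversely,
    two paths sharing a vertex both equal the only path through it. *)
Lemma is_path_coverE (G : sgraph) k (P : {set #|G|.-bseq G}) :
  is_path_cover k P = (#|P| == k) && path_cover (@adj G) P.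
Proof.
rewrite /is_path_cover; congr andb; congr andb.
apply/andP/forallP => [[/forall_inP disjP /forallP coverP] v|coverP].
  have /exists_inP[p Pp pv] := coverP v; apply/cards1P; exists p.
  apply/setP=> q; rewrite !inE; apply/andP/eqP => [[Pq qv]|->//].
  apply/eqP; apply: contraT => qNp; have /forall_inP/(_ q Pq) := disjP p Pp.
  by rewrite eq_sym qNp => /pred0P/(_ v); rewrite /= pv qv.
split; last first.
  apply/forallP=> v; have /cards1P[p Ep] := coverP v.
  have: p \in [set p] by rewrite inE.
  by rewrite -Ep inE => /andP[Pp pv]; apply/exists_inP; exists p.
apply/forall_inP=> p Pp; apply/forall_inP=> q Pq; apply/implyP.
apply: contraNT => /pred0Pn[v /= /andP[pv qv]].
have /cards1P[r Er] := coverP v; apply/eqP; transitivity r.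
  by apply/set1P; rewrite -Er inE Pp.
by apply/esym/set1P; rewrite -Er inE Pq.
Qed.

Lemma path_cover_polyE (R : realType) (G : sgraph) :
  path_cover_poly R G = \sum_(P : {set #|G|.-bseq G} | path_cover (@adj G) P)
    (-1) ^+ (#|G| - #|P|) *: 'X^#|P|.
Proof.
rewrite /path_cover_poly.
have numE k : (num_path_covers G k)%:R
    = \sum_(P : {set #|G|.-bseq G} | path_cover (@adj G) P) (#|P| == k)%:R :> R.
  rewrite -natr_sum /num_path_covers -[in LHS]sum1_card; congr _%:R.
  rewrite big_mkcond [in RHS]big_mkcond /=.
  apply: eq_bigr => P _; rewrite inE is_path_coverE andbC.
  by case: (path_cover _ _) => //=; case: eqP.
under eq_bigr => k _ do rewrite numE mulr_sumr scaler_suml.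
rewrite exchange_big /=; apply: eq_bigr => P coverP.
(* These bounds place [#|P|] in the summation range of [k], so each cover is counted exactly
   once. *)
have := card_path_cover (leqnn _) (vertex_gt0 G) coverP => /andP[P_gt0 leP].
rewrite (bigD1_seq #|P|) ?iota_uniq ?mem_index_iota ?P_gt0 //= eqxx mulr1.
rewrite big1 ?addr0 // => k /negPf kNP.
by rewrite eq_sym kNP mulr0 scale0r.
Qed.

Lemma card_porbits1 (T : finType) (s : {perm T}) : (0 < #|T|)%N ->
  (#|porbits s| == 1%N) = (porbits s == [set [set: T]]).
Proof.
case/card_gt0P=> x _; apply/idP/eqP; last by move->; rewrite cards1.
case/cards1P=> B EB.
rewrite EB; congr [set _]; apply/setP=> y; rewrite inE.
have: porbit s y \in porbits s by apply: imset_f.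
by rewrite EB => /set1P<-; rewrite porbit_id.
Qed.

Section Join.
Variables G H : sgraph.
Notation nonadj := (sum_rel (@adj (graph_compl G)) (@adj (graph_compl H))).

(** Following arcs of the disjoint union, the orbit of a vertex of [G] never reaches [H]. *)
Lemma no_cyclic_nonadj (s : {perm G + H}) :
  #|porbits s| == 1%N -> ~~ [forall v, nonadj v (s v)].
Proof.
rewrite card_porbits1 ?join_vertex_gt0 // => /eqP s1; apply/negP=> /forallP nadj.
have /card_gt0P[x _] := vertex_gt0 G; have /card_gt0P[y _] := vertex_gt0 H.
have: porbit s (inl x) \in porbits s by apply: imset_f.
rewrite s1 => /set1P/setP/(_ (inr y)); rewrite [in RHS]inE => /porbitP[i].
suff [z ->] : exists z, (s ^+ i)%g (inl x) = inl z by [].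
elim: i => [|i [z Ez]]; first by exists x; rewrite perm1.
rewrite expgSr permM Ez; have := nadj (inl z).
by case: (s (inl z)) => // w _; exists w.
Qed.

Lemma num_ham_cycles_join :
  num_ham_cycles (graph_join G H)
  = #|[set s : {perm G + H} | #|porbits s| == 1%N & [forall v, ~~ nonadj v (s v)]]|.
Proof.
apply: eq_card => s; rewrite !inE card_porbits1 ?join_vertex_gt0 //.
apply: andb_id2l => /eqP s1.
(* On the diagonal, join adjacency and the negation of [nonadj] disagree. The join has at least two
   vertices, so a cyclic [s] fixes none and never meets the diagonal. *)
have sNv v : s v != v.
  apply/eqP=> sv; have: porbit s v \in porbits s by apply: imset_f.
  rewrite s1 => /set1P/setP orb_v.
  have orb u : u = v.
    have: u \in porbit s v by rewrite orb_v inE.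
    case/porbitP=> i ->.
    by elim: i => [|i IHi]; rewrite ?perm1 // expgSr permM IHi.
  have /card_gt0P[x _] := vertex_gt0 G; have /card_gt0P[y _] := vertex_gt0 H.
  by have := orb (inl x); rewrite -(orb (inr y)).
apply: eq_forallb => v; have := sNv v.
case: v (s v) => x [y|y] //= sNx; rewrite negb_and !negbK.
  by rewrite (negPf (_ : x != y)) //; apply: contraNneq sNx => ->.
by rewrite (negPf (_ : x != y)) //; apply: contraNneq sNx => ->.
Qed.

End Join.

Theorem theorem3p6 (R : realType) (G H : sgraph) :
  pairing (path_cover_poly R (graph_compl G)) (path_cover_poly R (graph_compl H))
  = ((num_ham_cycles (graph_join G H))%:R : R)%:E.
Proof.
have cardGH : #|{: G + H}| = (#|G| + #|H|)%N by rewrite card_sum.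
have G_gt0 := vertex_gt0 G; have H_gt0 := vertex_gt0 H.
have adj_sym_sum : symmetric (sum_rel (@adj (graph_compl G)) (@adj (graph_compl H))).
  by case=> x [y|y] //=; exact: compl_adj_sym.
rewrite !path_cover_polyE pairing_sum => [|P coverP]; last first.
  by have /andP[] := card_path_cover (leqnn _) (vertex_gt0 (graph_compl G)) coverP.
rewrite num_ham_cycles_join (@card_cyclic_avoid_path_covers R _ _ (#|G| + #|H|)) //.
- rewrite (path_cover_sum_rel _ _ (m1 := #|G|) (m2 := #|H|) _ _ _ _
    (fun k => (-1) ^+ (#|{: G + H}| - k) * (k.-1)`!%:R)) ?leq_addr ?leq_addl //.
  congr EFin; apply: eq_bigr => P1.
  move=> /card_path_cover-/(_ (leqnn _) G_gt0)/andP[_ leP1].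
  apply: eq_bigr => P2 /card_path_cover-/(_ (leqnn _) H_gt0)/andP[_ leP2].
  rewrite cardGH -exprD; congr (_ ^+ _ * _).
  (* The signs multiply correctly because [leP1] and [leP2] keep the natural subtractions from
     truncating. *)
  by rewrite subnDA -addnBAC // addnBA.
- by rewrite cardGH addn_gt0 G_gt0.
- by rewrite cardGH.
- exact: no_cyclic_nonadj.
Qed.
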